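(* Let $\tilde h_{1,n,m}\colon\{0,1\}^{nm\lceil\log|\Sigma|\rceil}\to\{0,1\}$ be the Boolean function associated with $h_{1,n,m}$. Then its approximate degree satisfies $\widetilde{\deg}(\tilde h_{1,n,m})=\tilde O(\sqrt n+\sqrt m)$.
   Context: Let $n,m$ be positive integers, $M=[n]\times[m]$ (a grid of cells with $n$ rows and $m$ columns), $\tilde M=M\cup\{\bot\}$ (pointers to cells, $\bot$ the null pointer). Let $T$ be the following fixed binary tree with $m$ leaves and $m-1$ internal nodes: if $m=2^r$, $T$ is the complete binary tree with $2^r$ leaves; if $2^r<m<2^{r+1}$, take the complete binary tree with $2^r$ leaves and add a pair of children to each of its $m-2^r$ leftmost leaves. Outgoing arcs are labeled 'left'/'right', leaves labeled $1,\dots,m$ from left to right, and $T(j)$ is the sequence of labels on the root-to-leaf-$j$ path. The alphabet is $\Sigma=\{0,1\}\times\tilde M\times\tilde M\times\tilde M$ with components $\mathrm{val},\mathrm{lpoint},\mathrm{rpoint},\mathrm{ipoint}$. The function $h_{1,n,m}\colon\Sigma^M\to\{0,1\}$ has $h_{1,n,m}(x)=1$ iff: (1) there is exactly one column $b$ with $\mathrm{val}(x_{i,b})=1$ for all $i\in[n]$ (marked column); (2) column $b$ contains a unique cell $a$ with $x_{a}\ne(1,\bot,\bot,\bot)$ (special element); (3) $\mathrm{ipoint}(x_{a})=a$; (4) for each column $j\ne b$, the path starting at $a$ and following $\mathrm{lpoint},\mathrm{rpoint}$ as specified by $T(j)$ exists (no $\bot$ on it) and ends at a cell $\ell_j$ in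 column $j$ with $\mathrm{val}(x_{\ell_j})=0$. The associated Boolean function: fix a surjection $\beta\colon\{0,1\}^{\lceil\log|\Sigma|\rceil}\to\Sigma$ and let $\tilde h_{1,n,m}(y)=h_{1,n,m}(\beta(y))$, with $\beta$ applied blockwise to each cell's block of bits. The approximate degree $\widetilde{\deg}(f)$ of a Boolean function $f$ is the minimum degree of a real multilinear polynomial $p$ with $|p(y)-f(y)|\le 1/10$ for all Boolean inputs $y$. $\tilde O$ hides factors polylogarithmic in $n,m$. *)

(* Defs.v *)
From Stdlib Require Import Reals ClassicalEpsilon.
From mathcomp Require Import all_boot all_order all_algebra.
From mathcomp Require Import Rstruct.

Set Implicit Arguments.
Unset Strict Implicit.
Unset Printing Implicit Defensive.

Definition mpoly_eval (I : finType) (c : {set I} -> R) (y : I -> bool) : R :=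
  (\sum_(S : {set I}) c S * \prod_(i in S) (if y i then 1 else 0))%R.

Definition b2R (b : bool) : R := if b then 1%R else 0%R.

Definition approx_by (I : finType) (f : (I -> bool) -> bool) (d : nat) : Prop :=
  exists c : {set I} -> R,
    (forall S : {set I}, (d < #|S|)%N -> c S = 0%R) /\
    (forall y : I -> bool, (Rabs (mpoly_eval c y - b2R (f y)) <= 1/10)%R).

Definition approx_by_b (I : finType) (f : (I -> bool) -> bool) (d : nat) : bool :=
  if excluded_middle_informative (approx_by f d) then true else false.

(* the approximate degree: the least d with approx_by f d
   (such a d always exists, e.g. d = #|I|; the default 0 is never used) *)
Definition adeg (I : finType) (f : (I -> bool) -> bool) : nat :=
  match excluded_middle_informative (exists d, approx_by_b f d) with
  | left H => ex_minn H
  | right _ => 0%N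
  end.

Inductive btree := Leaf | Node of btree & btree.

Fixpoint complete_tree (r : nat) : btree :=
  match r with 0 => Leaf | r'.+1 => Node (complete_tree r') (complete_tree r') end.

Fixpoint expand_left (t : btree) (k : nat) : btree * nat :=
  match t with
  | Leaf => if k is k'.+1 then (Node Leaf Leaf, k') else (Leaf, 0%N)
  | Node l r =>
      let (l', k1) := expand_left l k in
      let (r', k2) := expand_left r k1 in
      (Node l' r', k2)
  end.

Definition treeT (m : nat) : btree :=
  let r := trunc_log 2 m in (expand_left (complete_tree r) (m - 2 ^ r)).1.

Fixpoint leaf_paths (t : btree) : seq (seq bool) :=
  match t with
  | Leaf => [:: [::]]
  | Node l r => map (cons false) (leaf_paths l) ++ map (cons true) (leaf_paths r)
  end.

(* T(j) for the column j : 'I_m (0-indexed column j is the leaf labelled j+1) *)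
Definition Tpath (m : nat) (j : 'I_m) : seq bool := nth [::] (leaf_paths (treeT m)) j.

Definition cell (n m : nat) := ('I_n * 'I_m)%type.
Definition ptr (n m : nat) := option (cell n m).
Definition Sigma (n m : nat) := (bool * ptr n m * ptr n m * ptr n m)%type.

Definition sval n m (s : Sigma n m) : bool := s.1.1.1.
Definition lpoint n m (s : Sigma n m) : ptr n m := s.1.1.2.
Definition rpoint n m (s : Sigma n m) : ptr n m := s.1.2.
Definition ipoint n m (s : Sigma n m) : ptr n m := s.2.

Definition plain_one n m : Sigma n m := (true, None, None, None).

Fixpoint follow n m (x : cell n m -> Sigma n m) (a : cell n m) (p : seq bool)
  : option (cell n m) :=
  match p with
  | [::] => Some a
  | b :: p' =>
      match (if b then rpoint (x a) else lpoint (x a)) with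
      | None => None
      | Some c => follow x c p'
      end
  end.

Definition marked_col n m (x : cell n m -> Sigma n m) (b : 'I_m) : bool :=
  [forall i : 'I_n, sval (x (i, b))].

Definition h1 n m (x : cell n m -> Sigma n m) : bool :=
  [exists b : 'I_m,
    [&& marked_col x b,
        [forall b' : 'I_m, marked_col x b' ==> (b' == b)] &
        [exists i : 'I_n,
          [&& x (i, b) != plain_one n m,
              [forall i' : 'I_n, (x (i', b) != plain_one n m) ==> (i' == i)],
              ipoint (x (i, b)) == Some (i, b) &
              [forall j : 'I_m, (j != b) ==>
                 match follow x (i, b) (Tpath j) with
                 | Some l => (l.2 == j) && ~~ sval (x l)
                 | None => false
                 end]]]]].

Definition nbits (n m : nat) : nat := up_log 2 #|{: Sigma n m}|.

Definition bitvar (n m : nat) := (cell n m * 'I_(nbits n m))%type.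

Definition htilde n m (beta : {ffun 'I_(nbits n m) -> bool} -> Sigma n m)
  (y : bitvar n m -> bool) : bool :=
  h1 (fun c : cell n m => beta [ffun k => y (c, k)]).

Definition surjective (A B : Type) (f : A -> B) : Prop := forall b : B, exists a : A, f a = b.

(* Main.v *)
(** A cell [a] is the special element of a positive instance iff [n + m]
    conditions hold: one per cell of its column, and one per column, each being
    decided by following a single pointer path and hence a polynomial of
    polylogarithmic degree. Marked column and special element are unique, so
    [h1] is exactly the sum over [a] of these conjunctions, and it suffices to
    approximate each of them up to error [1 / (10 n m)]. With [K] the number of
    violated conditions, a rescaled Chebyshev polynomial of degree
    O(sqrt (n + m)) is [1] at [K = 0] and at most [1/2] at every other possible
    value of [K]; raising it to a logarithmic power gives the required error. *)

Require Import Defs.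
From Stdlib Require Import Reals ClassicalEpsilon.
From mathcomp Require Import all_boot all_order all_algebra.
From mathcomp Require Import Rstruct ring lra zify.

Set Implicit Arguments.
Unset Strict Implicit.
Unset Printing Implicit Defensive.

Import Order.TTheory GRing.Theory Num.Theory.

Local Open Scope ring_scope.

(** * Chebyshev polynomials and the separation of 0 from the positive integers up to [d ^ 2] *)

Section Chebyshev.

Variable F : realFieldType.
Implicit Types (x : F) (d k : nat).

(* [T_d] and [U_(d-1)]: with [x = cos t], multiply [T + i (sin t) U] by [cos t + i sin t]. *)
Fixpoint cheb d : {poly F} * {poly F} :=
  if d is d'.+1 then
    let: (T, U) := cheb d' in ('X * T - (1 - 'X^2) * U, 'X * U + T)
  else (1, 0).

Lemma size_cheb d :
  (size (cheb d).1 <= d.+1)%N /\ (size (cheb d).2 <= d)%N.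
Proof.
elim: d => [|d] /=; first by rewrite size_poly1 size_poly0.
case: (cheb d) => T U /= [sT sU]; split.
  rewrite (leq_trans (size_polyD _ _)) // geq_max size_polyN.
  rewrite !(leq_trans (size_polyMleq _ _)) //; last by rewrite size_polyX.
  have: (size (1 - 'X^2 : {poly F})%R <= 3)%N.
    by rewrite (leq_trans (size_polyD _ _)) // size_polyN size_poly1 size_polyXn.
  by move=> s3; rewrite -subn1 leq_subLR (leq_trans (leq_add s3 sU)).
rewrite (leq_trans (size_polyD _ _)) // geq_max sT andbT.
by rewrite (leq_trans (size_polyMleq _ _)) // size_polyX.
Qed.

(** This is [cos^2 + sin^2 = 1]: the recurrence multiplies the form on the left by
    [x^2 + (1 - x^2) = 1]. *)
Lemma cheb_pell d x :
  (cheb d).1.[x] ^+ 2 + (1 - x ^+ 2) * (cheb d).2.[x] ^+ 2 = 1.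
Proof.
elim: d => [|d] /=; first by rewrite !hornerE /= expr1n !mulr0 addr0.
case: (cheb d) => T U /= IH.
by rewrite -[RHS]IH !(hornerD, hornerM, hornerN, hornerX, hornerC 1); ring.
Qed.

Lemma norm_cheb_le1 d x : `|x| <= 1 -> `|(cheb d).1.[x]| <= 1.
Proof.
move=> x1; have x2 : x ^+ 2 <= 1.
  by rewrite -(expr_le1 (n := 2)) // in x1; rewrite -(real_normK (num_real x)).
rewrite -(expr_le1 (n := 2)) // real_normK ?num_real //.
by rewrite -(cheb_pell d x) lerDl mulr_ge0 ?sqr_ge0 ?subr_ge0.
Qed.

(** Beyond 1 the factor [1 - (1 + x)^2] is nonpositive, so both recurrences have only nonnegative
    terms. The bounds go by a joint induction, since the growth of [T] feeds on that of [U]. *)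
Lemma cheb_ge d x : 0 <= x ->
  1 + d%:R ^+ 2 * x <= (cheb d).1.[1 + x] /\ d%:R <= (cheb d).2.[1 + x].
Proof.
move=> x0; elim: d => [|d] /=; first by rewrite !hornerE expr0n /= mul0r addr0.
case: (cheb d) => T U /= [].
rewrite !(hornerD, hornerM, hornerN, hornerX, hornerXn, hornerC 1).
move: T.[_] U.[_] => t u ht hu.
have d0 : 0 <= d%:R :> F by [].
by rewrite -natr1; split; nra.
Qed.

(* The Chebyshev polynomial rescaled so that [1 .. d^2] lands in [0, 1] and 0
   lands at 1 + 1/d^2, where it already exceeds 2. *)
Lemma exists_poly_separating0 d : (0 < d)%N ->
  exists p : {poly F}, [/\ (size p <= d.+1)%N, p.[0] = 1 &
    forall k, (0 < k <= d ^ 2)%N -> `|p.[k%:R]| <= 2^-1].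
Proof.
move=> d0; set c : F := (d%:R ^+ 2)^-1.
have c0 : 0 < c by rewrite invr_gt0 exprn_gt0 // ltr0n.
have cK : d%:R ^+ 2 * c = 1 by rewrite divff // expf_neq0 // pnatr_eq0 -lt0n.
set t := (cheb d).1.[1 + c].
have t2 : 2 <= t.
  by have [+ _] := cheb_ge d (ltW c0); rewrite cK; apply: le_trans; lra.
exists (t^-1 *: ((cheb d).1 \Po ((1 + c)%:P - c *: 'X))); split.
- rewrite (leq_trans (size_scale_leq _ _)) // (leq_trans (size_comp_poly_leq _ _)) //.
  have [sT _] := size_cheb d; rewrite ltnS -[leqRHS]muln1 leq_mul //.
    by case: size sT.
  have: (size ((1 + c)%:P - c *: 'X)%R <= 2)%N.
    rewrite (leq_trans (size_polyD _ _)) // geq_max size_polyN.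
    rewrite (leq_trans (size_polyC_leq1 _)) //=.
    by rewrite (leq_trans (size_scale_leq _ _)) // size_polyX.
  by case: size => [|[|[]]].
- rewrite hornerZ horner_comp !(hornerD, hornerZ, hornerN, hornerX, hornerC).
  by rewrite mulr0 subr0 mulVf //; lra.
move=> k /andP[k1 kd].
rewrite hornerZ horner_comp !(hornerD, hornerZ, hornerN, hornerX, hornerC).
have hk1 : 1 <= k%:R :> F by rewrite ler1n.
have hkd : k%:R <= d%:R ^+ 2 :> F by rewrite -natrX ler_nat.
have hx : `|1 + c - c * k%:R| <= 1 by rewrite ler_norml; nra.
have := norm_cheb_le1 d hx; move: (horner _ _) => v hv.
rewrite normrM normfV (ger0_norm (_ : 0 <= t)); last lra.
rewrite -[leRHS]mulr1 ler_pM // ?invr_ge0 ?lef_pV2 ?posrE; lra.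
Qed.

End Chebyshev.

(** * Closure properties of degree for real functions on the Boolean cube *)

Section Degree.

Variable I : finType.
Implicit Types (f g : (I -> bool) -> R) (y : I -> bool) (S : {set I}).

(** The exact counterpart of [approx_by]; as a predicate on functions, it lets degree bounds compose
    without exhibiting coefficients. *)
Definition deg_le (d : nat) f : Prop :=
  exists c : {set I} -> R,
    (forall S, (d < #|S|)%N -> c S = 0) /\ forall y, f y = mpoly_eval c y.

Lemma deg_le_ext d f g : f =1 g -> deg_le d g -> deg_le d f.
Proof. by move=> fg [c [cd gE]]; exists c; split=> // y; rewrite fg. Qed.

Lemma deg_le_leq d e f : (d <= e)%N -> deg_le d f -> deg_le e f.
Proof.
move=> de [c [cd fE]]; exists c; split=> // S eS.
by apply: cd; apply: leq_ltn_trans eS.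
Qed.

Lemma monomialE S y :
  \prod_(i in S) (if y i then 1 else 0) = (S \subset [set i | y i])%:R :> R.
Proof.
case: subsetP => [Sy|nSy].
  by rewrite big1 // => i /Sy; rewrite inE => ->.
have [i iS yi] : exists2 i, i \in S & ~~ y i.
  apply/exists_inP/negP => /exists_inP nex; apply: nSy => i iS.
  by rewrite inE; apply/negPn/negP => yi; apply: nex; exists i.
by rewrite (bigD1 i) //= (negPf yi) mul0r.
Qed.

Lemma mpoly_evalE (c : {set I} -> R) y :
  mpoly_eval c y = \sum_S c S * (S \subset [set i | y i])%:R.
Proof. by apply: eq_bigr => S _; rewrite monomialE. Qed.

Lemma deg_le_cst d (a : R) : deg_le d (fun=> a).
Proof.
exists (fun S => a *+ (S == set0)); split=> [S dS|y].
  by case: eqP dS => // ->; rewrite cards0.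
rewrite mpoly_evalE (bigD1 set0) //= big1 ?addr0 => [|S /negPf->]; last first.
  by rewrite mul0r.
by rewrite eqxx sub0set mulr1.
Qed.

Lemma deg_le_var i : deg_le 1 (fun y => (y i)%:R).
Proof.
exists (fun S => (S == [set i])%:R); split=> [S dS|y].
  by case: eqP dS => // ->; rewrite cards1.
rewrite mpoly_evalE (bigD1 [set i]) //= big1 ?addr0 => [|S /negPf->]; last first.
  by rewrite mul0r.
by rewrite eqxx mul1r sub1set inE.
Qed.

Lemma deg_leD d f g : deg_le d f -> deg_le d g -> deg_le d (fun y => f y + g y).
Proof.
move=> [c [cd fE]] [c' [cd' gE]]; exists (fun S => c S + c' S); split=> [S dS|y].
  by rewrite cd ?cd' ?addr0.
by rewrite fE gE !mpoly_evalE -big_split; apply: eq_bigr => S _; rewrite mulrDl.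
Qed.

(** On Boolean inputs the monomials of [A] and [B] multiply to that of [A :|: B], so the coefficient
    of [S] collects all pairs with union [S]. *)
Lemma deg_leM d e f g :
  deg_le d f -> deg_le e g -> deg_le (d + e) (fun y => f y * g y).
Proof.
move=> [c [cd fE]] [c' [cd' gE]].
exists (fun S => \sum_(p : {set I} * {set I} | p.1 :|: p.2 == S) c p.1 * c' p.2).
split=> [S dS|y].
  apply: big1 => -[A B] /= /eqP ABS.
  have [dA|Ad] := ltnP d #|A|; first by rewrite cd ?mul0r.
  have [eB|Be] := ltnP e #|B|; first by rewrite cd' ?mulr0.
  have SAB : (#|S| <= #|A| + #|B|)%N by rewrite -ABS cardsU leq_subr.
  by have := leq_trans dS (leq_trans SAB (leq_add Ad Be)); rewrite ltnn.
rewrite fE gE !mpoly_evalE big_distrlr /= pair_big /=.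
rewrite (partition_big (fun p : {set I} * {set I} => p.1 :|: p.2) xpredT) //=.
apply: eq_bigr => S _; rewrite big_distrl /=; apply: eq_bigr => -[A B] /= /eqP <-.
by rewrite subUset mulrACA -natrM mulnb.
Qed.

Lemma deg_leZ d (a : R) f : deg_le d f -> deg_le d (fun y => a * f y).
Proof. exact: (@deg_leM 0 d _ _ (deg_le_cst 0 a)). Qed.

Lemma deg_le_sum d (J : Type) (r : seq J) (P : pred J) (f : J -> (I -> bool) -> R) :
  (forall j, P j -> deg_le d (f j)) -> deg_le d (fun y => \sum_(j <- r | P j) f j y).
Proof.
move=> fd; elim: r => [|j r IH].
  by apply: deg_le_ext (deg_le_cst d 0) => y; rewrite big_nil.
have [Pj|nPj] := boolP (P j).
  by apply: deg_le_ext (deg_leD (fd _ Pj) IH) => y; rewrite big_cons Pj.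
by apply: deg_le_ext IH => y; rewrite big_cons (negPf nPj).
Qed.

Lemma deg_le_prod d (J : finType) (f : J -> (I -> bool) -> R) :
  (forall j, deg_le d (f j)) -> deg_le (#|J| * d) (fun y => \prod_j f j y).
Proof.
move=> fd.
apply: (@deg_le_ext _ _ (fun y => \prod_(j <- enum J) f j y)) => [y|].
  by rewrite big_enum.
rewrite cardE; elim: (enum J) => [|j r IH].
  by apply: deg_le_ext (deg_le_cst _ 1) => y; rewrite big_nil.
by apply: deg_le_ext (deg_leM (fd j) IH) => y; rewrite big_cons.
Qed.

Lemma deg_le_exp d n f : deg_le d f -> deg_le (n * d) (fun y => f y ^+ n).
Proof.
move=> fd; elim: n => [|n IH]; first exact: (deg_le_cst 0 1).
by apply: deg_le_ext (deg_leM fd IH) => y; rewrite exprS.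
Qed.

Lemma deg_le_horner d k (p : {poly R}) f :
  (size p <= k.+1)%N -> deg_le d f -> deg_le (k * d) (fun y => p.[f y]).
Proof.
move=> pk fd.
apply: deg_le_ext (fun y => horner_coef_wide (f y) pk) _.
apply: deg_le_sum => i _; apply: deg_leZ.
apply: deg_le_leq (deg_le_exp i fd).
by rewrite leq_mul2r -ltnS ltn_ord orbT.
Qed.

(** Interpolation: sum over all assignments [v] the value [g v] times the indicator of [v], a
    product of [#|A|] literals. *)
Lemma deg_le_junta (A : finType) (h : A -> I) (g : {ffun A -> bool} -> R) :
  deg_le #|A| (fun y => g [ffun k => y (h k)]).
Proof.
apply: (@deg_le_ext _ _ (fun y => \sum_v g v * \prod_k (y (h k) == v k)%:R)) => [y|].
  rewrite (bigD1 [ffun k => y (h k)]) //= big1 ?mulr1 => [|k _]; last first.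
    by rewrite ffunE eqxx.
  rewrite big1 ?addr0 // => v nv.
  have /existsP[k yk] : [exists k, y (h k) != v k].
    rewrite -negb_forall; apply: contra nv => /forallP yv.
    by apply/eqP/ffunP => k; rewrite ffunE; apply/esym/eqP.
  by rewrite (bigD1 k) //= (negPf yk) mul0r mulr0.
apply: deg_le_sum => v _; apply: deg_leZ.
rewrite -[#|A|]muln1; apply: deg_le_prod => k.
case: (v k).
  by apply: deg_le_ext (deg_le_var (h k)) => y; rewrite eqb_id.
apply: deg_le_ext (deg_leD (deg_le_cst 1 1) (deg_leZ (-1) (deg_le_var (h k)))).
by move=> y; case: (y _); rewrite mulN1r ?subrr ?subr0.
Qed.

Lemma b2RE b : b2R b = b%:R.
Proof. by case: b. Qed.

Lemma adeg_leq (f : (I -> bool) -> bool) d g :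
  deg_le d g -> (forall y, `|g y - (f y)%:R| <= 10^-1) -> (adeg f <= d)%N.
Proof.
move=> [c [cd gE]] gf.
have fd : approx_by_b f d.
  rewrite /approx_by_b; case: excluded_middle_informative => // -[].
  by exists c; split=> // y; rewrite -gE b2RE !RealsE div1r.
rewrite /adeg; case: excluded_middle_informative => [ex|nex]; last by case: nex; exists d.
by case: ex_minnP => k _; apply.
Qed.

End Degree.

(** * Approximation of a conjunction of low-degree conditions *)

Section And.

Variables (I J : finType) (P : J -> (I -> bool) -> bool).

(** The count [K] of violated conditions is a sum, so its degree is still [e]. The power [s] fixes
    the value 1 at [K = 0] and shrinks the bound 1/2 elsewhere. *)
Lemma approx_forall d e s :
  (0 < d)%N -> (#|J| <= d ^ 2)%N -> (forall j, deg_le e (fun y => (P j y)%:R)) ->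
  exists2 g, deg_le (s * (d * e)) g &
    forall y, `|g y - [forall j, P j y]%:R| <= 2^-1 ^+ s :> R.
Proof.
move=> d0 Jd Pe; have [p [pd p0 p1]] := @exists_poly_separating0 R d d0.
pose K y := \sum_j (1 - (P j y)%:R) : R.
have KE y : K y = #|[pred j | ~~ P j y]|%:R.
  rewrite -sum1_card natr_sum big_mkcond /=; apply: eq_bigr => j _.
  by rewrite inE; case: (P j y); rewrite ?subrr ?subr0.
exists (fun y => p.[K y] ^+ s).
  apply/deg_le_exp/deg_le_horner => //; apply: deg_le_sum => j _.
  apply: deg_leD (deg_le_cst _ _ 1) _.
  by apply: deg_le_ext (deg_leZ (-1) (Pe j)) => y; rewrite mulN1r.
move=> y; rewrite KE; case: forallP => [Py|nPy].
  by rewrite eq_card0 ?p0 ?expr1n ?subrr ?normr0 ?exprn_ge0 ?invr_ge0 // => j; rewrite inE Py.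
rewrite subr0 normrX lerXn2r ?nnegrE ?invr_ge0 //.
apply: p1; rewrite (leq_trans (max_card _)) // andbT; apply/card_gt0P.
have /existsP[j Pj] : [exists j, ~~ P j y].
  by rewrite -negb_forall; apply/forallP.
by exists j.
Qed.

End And.

(** * Logarithmic length of the paths in the tree *)

Fixpoint height (t : btree) : nat :=
  if t is Node l r then (maxn (height l) (height r)).+1 else 0.

Lemma size_leaf_paths t p : p \in leaf_paths t -> (size p <= height t)%N.
Proof.
elim: t p => [|l IHl r IHr] p /=; first by rewrite inE => /eqP->.
rewrite mem_cat => /orP[] /mapP[q qt ->] /=; rewrite ltnS leq_max.
  by rewrite IHl.
by rewrite IHr ?orbT.
Qed.

Lemma height_complete_tree r : height (complete_tree r) = r.
Proof. by elim: r => //= r ->; rewrite maxnn. Qed.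

Lemma height_expand_left t k : (height (expand_left t k).1 <= (height t).+1)%N.
Proof.
elim: t k => [|l IHl r IHr] [|k] //=.
  have := IHl 0%N; case: expand_left => l' k1 /= hl.
  by have := IHr k1; case: expand_left => r' k2 /= hr; lia.
have := IHl k.+1; case: expand_left => l' k1 /= hl.
by have := IHr k1; case: expand_left => r' k2 /= hr; lia.
Qed.

Lemma size_Tpath m (j : 'I_m) : (size (Tpath j) <= (trunc_log 2 m).+1)%N.
Proof.
rewrite /Tpath; have [jT|Tj] := ltnP j (size (leaf_paths (treeT m))).
  rewrite (leq_trans (size_leaf_paths (mem_nth _ jT))) //.
  by rewrite (leq_trans (height_expand_left _ _)) // height_complete_tree.
(* An index past the list of leaves gives the default, empty path. *)
by rewrite nth_default.
Qed.

(** * Positive instances as a disjoint union of certificates *)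

Section Certificate.

Variables n m : nat.
Implicit Types (x : cell n m -> Sigma n m) (a : cell n m).

Definition leads_to_zero x a (j : 'I_m) : bool :=
  match follow x a (Tpath j) with
  | Some l => (l.2 == j) && ~~ Defs.sval (x l)
  | None => false
  end.

Definition is_special a (s : Sigma n m) : bool :=
  [&& s != plain_one n m, Defs.sval s & ipoint s == Some a].

(** The sum type puts the row and column conditions into one family, so that [cert] is a single
    conjunction. *)
Definition cert_cond a (t : 'I_n + 'I_m) x : bool :=
  match t with
  | inl i => if i == a.1 then is_special a (x a) else x (i, a.2) == plain_one n m
  | inr j => (j == a.2) || leads_to_zero x a j
  end.

Definition cert a x : bool := [forall t, cert_cond a t x].

(** Uniqueness of the marked column comes for free: the path for any other column ends there at a
    cell of value 0. *)
Lemma cert_marked_col a x b : cert a x -> marked_col x b = (b == a.2).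
Proof.
move=> /forallP ax; have [->|ba] := eqVneq b a.2.
  apply/forallP => i; have /= := ax (inl i); case: eqP => [->|_ /eqP->] //.
  by rewrite -surjective_pairing => /and3P[].
have /= := ax (inr b); rewrite (negPf ba) /= /leads_to_zero.
case: follow => // -[i j] /= /andP[/eqP-> xij].
by apply/negbTE/forallPn; exists i.
Qed.

Lemma cert_special a x i :
  cert a x -> (x (i, a.2) != plain_one n m) = (i == a.1).
Proof.
move=> /forallP /(_ (inl i)) /=; have [->|_ ->//] := eqVneq i a.1.
by rewrite -surjective_pairing => /and3P[].
Qed.

Lemma cert_inj a a' x : cert a x -> cert a' x -> a = a'.
Proof.
move=> ax ax'; rewrite [a]surjective_pairing [a']surjective_pairing.
have a2 : a.2 = a'.2.
  by apply/eqP; rewrite -(cert_marked_col a.2 ax') (cert_marked_col a.2 ax).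
congr pair => //; apply/eqP.
by rewrite -(cert_special a.1 ax') -a2 (cert_special a.1 ax).
Qed.

Lemma h1_cert x : h1 x = [exists a, cert a x].
Proof.
apply/existsP/existsP => [[b]|[a ax]].
  case/and3P => /forallP bx _ /existsP[i /and4P[ix /forallP iu xi /forallP jx]].
  exists (i, b); apply/forallP => -[i'|j] /=.
    have [_|ni] := eqVneq i' i; first by rewrite /is_special ix xi bx.
    by apply: contraNT ni; apply/implyP.
  by have := jx j; rewrite implybE negbK.
exists a.2; apply/and3P; split.
- by rewrite (cert_marked_col _ ax).
- by apply/forallP => b; rewrite (cert_marked_col b ax) implybb.
have /= := forallP ax (inl a.1); rewrite eqxx => /and3P[xa _ xaa].
apply/existsP; exists a.1; rewrite -surjective_pairing; apply/and4P; split=> //.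
  by apply/forallP => i; rewrite (cert_special i ax) implybb.
by apply/forallP => j; have /= := forallP ax (inr j); rewrite implybE negbK.
Qed.

(** By [cert_inj] at most one summand is 1, so the disjunction is a sum, which does not raise the
    degree. *)
Lemma h1_sum_cert x : (h1 x)%:R = \sum_a (cert a x)%:R :> R.
Proof.
rewrite h1_cert; case: existsP => [[a ax]|nx].
  rewrite (bigD1 a) //= ax big1 ?addr0 // => a'.
  by case: (boolP (cert a' x)) => // /(cert_inj ax) ->; rewrite eqxx.
by rewrite big1 // => a _; case: (boolP (cert a x)) => // ax; case: nx; exists a.
Qed.

End Certificate.

(** * Degree in the input bits *)

Section Decoding.

Variables (n m : nat) (beta : {ffun 'I_(nbits n m) -> bool} -> Sigma n m).
Implicit Types (a c : cell n m) (y : bitvar n m -> bool).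

Definition decode y : cell n m -> Sigma n m := fun c => beta [ffun k => y (c, k)].

Lemma deg_le_cell c (g : Sigma n m -> bool) :
  deg_le (nbits n m) (fun y => (g (decode y c))%:R).
Proof.
have := @deg_le_junta _ _ (fun k => (c, k)) (fun v => (g (beta v))%:R).
by rewrite card_ord.
Qed.

(** Branch on the target [c] of the first pointer: its indicator reads one block of bits, and
    summing over [c] costs no degree. A null pointer makes every summand 0. *)
Lemma deg_le_follow a p e (Q : cell n m -> (bitvar n m -> bool) -> bool) :
  (forall l, deg_le e (fun y => (Q l y)%:R)) ->
  deg_le (size p * nbits n m + e)
    (fun y => (oapp (Q^~ y) false (follow (decode y) a p))%:R).
Proof.
move=> Qe; elim: p a => [|b p IH] a; first exact: Qe.
pose step (s : Sigma n m) := if b then rpoint s else lpoint s.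
rewrite mulSn -addnA.
apply: (@deg_le_ext _ _ _ (fun y => \sum_c (step (decode y a) == Some c)%:R *
    (oapp (Q^~ y) false (follow (decode y) c p))%:R)) => [y|].
  rewrite /= -/(step _); case: (step _) => [c|]; last by rewrite big1 // => c _; rewrite mul0r.
  rewrite (bigD1 c) //= eqxx mul1r big1 ?addr0 // => c' /negPf c'c.
  by rewrite (inj_eq Some_inj) eq_sym c'c mul0r.
by apply: deg_le_sum => c _; apply: deg_leM (IH c); apply: deg_le_cell (fun s => step s == Some c).
Qed.

(** At most [(trunc_log 2 m).+1] pointers are read along a path, plus one block for the value at its
    end. *)
Lemma deg_le_cert_cond a t :
  deg_le ((trunc_log 2 m).+2 * nbits n m)
    (fun y => (cert_cond a t (decode y))%:R).
Proof.
case: t => [i|j] /=.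
  apply: (@deg_le_leq _ (nbits n m)); first by rewrite leq_pmull.
  case: (i == a.1); first exact: deg_le_cell.
  exact: (deg_le_cell _ (fun s => s == plain_one n m)).
case: (j == a.2) => /=; first exact: deg_le_cst.
apply: (@deg_le_leq _ (size (Tpath j) * nbits n m + nbits n m)).
  by rewrite addnC -mulSn leq_mul2r ltnS size_Tpath orbT.
pose Q l y := (l.2 == j) && ~~ Defs.sval (decode y l).
have Qe l : deg_le (nbits n m) (fun y => (Q l y)%:R).
  exact: (deg_le_cell l (fun s => (l.2 == j) && ~~ Defs.sval s)).
exact: (deg_le_follow a (Tpath j) Qe).
Qed.

Lemma adeg_htilde_leq d s :
  (0 < d)%N -> (n + m <= d ^ 2)%N -> (10 * (n * m) <= 2 ^ s)%N ->
  (adeg (htilde beta) <= s * (d * ((trunc_log 2 m).+2 * nbits n m)))%N.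
Proof.
move=> d0 nmd nms.
have cd : (#|{: 'I_n + 'I_m}| <= d ^ 2)%N by rewrite card_sum !card_ord.
have [g gd ge] := fin_all_exists2 (fun a =>
  approx_forall s d0 cd (deg_le_cert_cond a)).
apply: (@adeg_leq _ _ _ (fun y => \sum_a g a y)).
  by apply: deg_le_sum => a _; apply: gd.
move=> y; rewrite [htilde beta y]/(h1 (decode y)) h1_sum_cert -sumrB.
(* The errors of the [n * m] certificates add up to at most [n * m / 2 ^ s <= 1 / 10]. *)
apply: (le_trans (ler_norm_sum _ _ _)).
apply: (le_trans (ler_sum _ (fun a _ => ge a y))).
rewrite sumr_const card_prod !card_ord -[leLHS]mulr_natl exprVn.
rewrite ler_pdivrMr ?exprn_gt0 ?ltr0n // ler_pdivlMl ?ltr0n //.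
by rewrite -natrX -natrM ler_nat.
Qed.

End Decoding.

(** * Logarithmic estimates and the final bound *)

(** The alphabet has [2 * (n * m + 1) ^ 3] letters, and
    [n * m + 1 <= (n + m) ^ 2 <= 2 ^ (2 * l)]. *)
Lemma nbits_leq n m l : (0 < n)%N -> (0 < m)%N ->
  (n + m <= 2 ^ l)%N -> (nbits n m <= 6 * l + 1)%N.
Proof.
move=> n0 m0 nml; apply: up_log_min => //.
rewrite !card_prod !card_option card_bool card_prod !card_ord.
have nm : ((n * m).+1 <= 2 ^ l * 2 ^ l)%N.
  by apply: leq_trans (leq_mul nml nml); nia.
rewrite -expnD in nm.
have := leq_mul (leqnn 2) (leq_mul nm (leq_mul nm nm)).
by rewrite -!expnD -!expnS !mulnA => /leq_trans -> //; rewrite leq_exp2l //; lia.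
Qed.

(** Minimality of [up_log] gives [2 ^ l < N] for its predecessor [l]; then [ln 2 > 1 / 2] yields
    [l <= 2 * ln N]. *)
Lemma INR_up_log2 N : (1 < N)%N ->
  Rle (INR (up_log 2 N)) (Rmult 2 (Rplus R1 (ln (INR N)))).
Proof.
move=> N1; have := up_log_gtn (isT : 1 < 2)%N N1.
have : (0 < up_log 2 N)%N by rewrite up_log_gt0.
case: (up_log 2 N) => // l _ /= lN.
have : Rlt (pow 2 l) (INR N).
  rewrite (_ : IZR 2 = INR 2); last by rewrite INR_IZR_INZ.
  by apply/RltP; rewrite !RealsE -natrX ltr_nat.
have p2 : Rlt 0 (pow 2 l) by apply: pow_lt; Lra.lra.
move=> /(ln_increasing _ _ p2); rewrite ln_pow; last by Lra.lra.
have := ln_lt_2; have := pos_INR l; rewrite -/(INR l.+1) S_INR; Lra.nra.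
Qed.

Theorem theorem22 :
  forall beta : forall n m : nat, {ffun 'I_(nbits n m) -> bool} -> Sigma n m,
    (forall n m : nat, surjective (beta n m)) ->
    exists (C : R) (k : nat),
      forall n m : nat, (0 < n)%N -> (0 < m)%N ->
        Rle (INR (adeg (htilde (beta n m))))
            (Rmult (Rmult C (Rplus (sqrt (INR n)) (sqrt (INR m))))
                   (pow (Rplus R1 (ln (INR (n + m)))) k)).
Proof.
(* The three logarithms are the exponent [s], the path length and the bits per cell. The constant is
   [126 * 2 ^ 3 * 2], from [adeg_l3], [lr] and [dr]. *)
move=> beta _; exists (INR 2016), 3%N => n m n0 m0.
set l := up_log 2 (n + m); have nml : (n + m <= 2 ^ l)%N by apply: up_logP.
have l0 : (0 < l)%N by rewrite up_log_gt0 /=; lia.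
(* The successors compensate for rounding down, so the two squares alone exceed [n + m]. *)
pose d := ((Nat.sqrt n).+1 + (Nat.sqrt m).+1)%N.
have nmd : (n + m <= d ^ 2)%N.
  have := Nat.sqrt_spec n (Nat.le_0_l n); have := Nat.sqrt_spec m (Nat.le_0_l m).
  by rewrite /d; nia.
have nms : (10 * (n * m) <= 2 ^ (4 + (l + l)))%N.
  by rewrite !expnD leq_mul // leq_mul // (leq_trans _ nml) ?leq_addr ?leq_addl.
have lm : (trunc_log 2 m <= l)%N.
  rewrite -(leq_exp2l (m := 2)) // (leq_trans (trunc_logP _ _)) //.
  by rewrite (leq_trans _ nml) // leq_addl.
have adeg_l3 : (adeg (htilde (beta n m)) <= 126 * (l * l * l) * d)%N.
  apply: leq_trans (adeg_htilde_leq (beta n m) (isT : 0 < d)%N nmd nms) _.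
  have := nbits_leq n0 m0 nml; move: (nbits n m) => B Bl.
  (* Since [l >= 1], additive constants are absorbed into multiples of [l]; this gives
     [126 = 6 * 3 * 7]. *)
  have h1 : ((trunc_log 2 m).+2 * B <= (3 * l) * (7 * l))%N by apply: leq_mul; lia.
  have h2 : (4 + (l + l) <= 6 * l)%N by lia.
  apply: leq_trans (leq_mul h2 (leq_mul (leqnn d) h1)) _; lia.
have dr : Rle (INR d) (Rmult 2 (Rplus (sqrt (INR n)) (sqrt (INR m)))).
  (* For [k >= 1] the added 1 is itself at most [sqrt k]. *)
  have sq k : (0 < k)%N -> Rle (INR (Nat.sqrt k).+1) (Rmult 2 (sqrt (INR k))).
    move=> k0; rewrite S_INR.
    have k1 : Rle 1 (sqrt (INR k)).
      by rewrite -sqrt_1; apply: sqrt_le_1_alt; apply: (le_INR 1%N); apply/ssrnat.leP.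
    suff: Rle (INR (Nat.sqrt k)) (sqrt (INR k)) by Lra.lra.
    rewrite -(sqrt_square (INR (Nat.sqrt k))); last exact: pos_INR.
    apply: sqrt_le_1_alt; rewrite -mult_INR; apply: le_INR.
    by have [] := Nat.sqrt_spec k (Nat.le_0_l k).
  by rewrite plus_INR; have := sq n n0; have := sq m m0; Lra.lra.
have lr : Rle (INR l) (Rmult 2 (Rplus R1 (ln (INR (n + m))))).
  by apply: INR_up_log2; lia.
have l3 := pow_incr _ _ 3%N (conj (pos_INR l) lr).
apply: Rle_trans (le_INR _ _ (elimT ssrnat.leP adeg_l3)) _.
rewrite !mult_INR; have := Rmult_le_compat _ _ _ _ (pow_le _ 3%N (pos_INR l)) (pos_INR d) l3 dr.
have -> : INR 2016 = Rmult 16 (INR 126) by rewrite !INR_IZR_INZ /=; Lra.lra.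
move=> /(Rmult_le_compat_l _ _ _ (pos_INR 126)).
set D := INR d; set X := INR 126; set L := ln _; set Y := Rplus (sqrt _) _.
by move=> H; apply: Rle_trans (Rle_trans _ _ _ _ H) _; rewrite /=; Lra.lra.
Qed.
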